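(* Let $M_6$ be any compact nilmanifold with underlying Lie algebra isomorphic to $\mathfrak{h}_6$, endowed, for $t\in\mathbb{R}\setminus\{0\}$, with the invariant balanced Hermitian structure $(J,g)$ depending on $t$ described in the context, with torsion $T$ and Bismut-Strominger connection $\nabla^+$. Let $A$ be the abelian $SU(3)$-instanton described in the context. Then $$dT=\frac{32\pi^2t^2}{8t^4-1}\,\big(p_1(\nabla^+)-p_1(A)\big)$$ whenever $8t^4\neq1$. Thus, for every $t$ with $t^4>\frac18$, $(M_6,J,g,A)$ is a solution to the heterotic supersymmetry equations with non-zero flux $H=T$ and constant dilaton which satisfies the three-form Bianchi identity for the $(+)$-connection.
   Context: Notation: $e^{ij}=e^i\wedge e^j$, etc. $\mathfrak{h}_6=(0,0,0,0,12,13)$, meaning it has a basis of $1$-forms with $de^1=\dots=de^4=0$, $de^5=e^{12}$, $de^6=e^{13}$. A compact nilmanifold is $\Gamma\backslash G$ with $G$ simply connected nilpotent and $\Gamma$ a lattice. The structure: $\mathfrak{h}_6$ has a basis of complex $(1,0)$-forms with $d\omega^1=d\omega^2=0$, $d\omega^3=\omega^{12}-\omega^{2\bar1}$. Put $e^1+ie^2=\omega^1$, $e^3+ie^4=\omega^2$, $e^5+ie^6=t\,\omega^3$. Then $de^1=de^2=de^3=de^4=0$, $de^5=2t\,e^{13}$, $de^6=2t\,e^{14}$. The metric is $g=\sum_ie^i\otimes e^i$, and with $(Je)(X)=-e(JX)$ the complex structure is $Je^1=-e^2$, $Je^3=-e^4$, $Je^5=-e^6$ (on the dual frame: $JE_2=E_1$,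 $JE_4=E_3$, $JE_6=E_5$). The Kaehler form $F(X,Y)=g(X,JY)$ is $F=e^{12}+e^{34}+e^{56}$. Connections: $T(X,Y,Z)=-dF(JX,JY,JZ)$; $g(\nabla^+_XY,Z)=g(\nabla^g_XY,Z)+\frac12T(X,Y,Z)$ with $\nabla^g$ the Levi-Civita connection. Balanced means $d*F=0$ (Lee form zero). Abelian instanton $A$: write $\omega^1=dz_1$, $\omega^2=dz_2$ on the Lie group. $A$ is an abelian connection ($U(1)=SO(2)$) on $M_6$ whose curvature is a real $2$-form of the shape $$\mathcal F=if\,dz_1\wedge d\bar z_1-if\,dz_2\wedge d\bar z_2+e^{i\gamma}\sqrt{\tfrac14-f^2}\,dz_1\wedge d\bar z_2-e^{-i\gamma}\sqrt{\tfrac14-f^2}\,dz_2\wedge d\bar z_1,$$ with real $f,\gamma$ (depending on $z_1,z_2$, $|f|\le\frac12$, $\mathcal F$ descending to $M_6$) satisfying $i\partial_{z_2}f+\partial_{z_1}(e^{-i\gamma}\sqrt{\frac14-f^2})=0$ and $i\partial_{z_1}f+\partial_{z_2}(e^{i\gamma}\sqrt{\frac14-f^2})=0$; $p_1(A)=\frac1{8\pi^2}\mathcal F\wedge\mathcal F$. Pontrjagin forms: for a metric connection with curvature $2$-forms $\Omega^i_j(X,Y)=g(R(X,Y)E_j,E_i)$ in an orthonormal frame, $p_1=\frac1{8\pi^2}\sum_{i<j}\Omega^i_j\wedge\Omega^i_j$. $SU(3)$-instanton: a connection whose curvature $\Omega$ satisfies $\Omega(JX,JY)=\Omega(X,Y)$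 and $\sum_{k=1}^6\Omega(E_k,JE_k)=0$. Heterotic supersymmetry equations with constant dilaton for $(M,J,g,A)$: (i) $Hol(\nabla^+)\subset\mathfrak{su}(3)$, i.e. $\sum_i g(R^+(X,Y)JE_i,E_i)=0$; (ii) $(J,g)$ is balanced; (iii) $A$ is an $SU(3)$-instanton. The three-form Bianchi identity for a connection $\nabla$ on $TM$: $dT=\frac{\alpha'}{4}8\pi^2\big(p_1(\nabla)-p_1(A)\big)$ for some constant $\alpha'>0$. *)

(* Defs.v *)
From HB Require Import structures.
From mathcomp Require Import all_boot all_order all_fingroup all_algebra.
From mathcomp Require Import complex.
From mathcomp Require Import all_classical all_reals all_analysis.

Set Implicit Arguments.
Unset Strict Implicit.
Unset Printing Implicit Defensive.

Import Order.TTheory GRing.Theory Num.Theory.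
Import numFieldNormedType.Exports.
Local Open Scope classical_set_scope.
Local Open Scope ring_scope.
Local Open Scope complex_scope.

(* The space 'rV[R]_6 plays two roles: it is the Lie algebra (with a bracket
   [br]) and, in exponential coordinates, the simply connected nilpotent Lie
   group G with that Lie algebra, the unit being 0. *)
Notation vec R := 'rV[R]_6.
Notation bracket R := (vec R -> vec R -> vec R).

Record is_lie_bracket (R : realType) (br : bracket R) : Prop := {
  lie_linear_l : forall Y, linear (fun X => br X Y);
  lie_linear_r : forall X, linear (br X);
  lie_alt : forall X, br X X = 0;
  lie_jacobi : forall X Y Z,
    br X (br Y Z) + br Y (br Z X) + br Z (br X Y) = 0 }.

(* Group law of G: the Baker-Campbell-Hausdorff series, which stops here
   because the Lie algebra h_6 is 2-step nilpotent. The inverse of p is -p. *)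
Definition bch (R : realType) (br : bracket R) (p q : vec R) : vec R :=
  p + q + 2^-1 *: br p q.

(* A lattice: discrete subgroup of G with compact quotient. *)
Record is_lattice (R : realType) (br : bracket R) (Gam : set (vec R)) : Prop := {
  lattice_one : Gam 0;
  lattice_mul : forall p q, Gam p -> Gam q -> Gam (bch br p q);
  lattice_inv : forall p, Gam p -> Gam (- p);
  lattice_discrete : exists2 U : set (vec R), nbhs (0 : vec R) U & Gam `&` U `<=` [set 0];
  lattice_cocompact : exists2 K : set (vec R), compact K &
    forall p, exists c k, [/\ Gam c, K k & p = bch br c k] }.

(* Derivative of phi at p along the left-invariant vector field X, whose
   integral curve through p is s |-> p * exp (s X). *)
Definition ldiff (R : realType) (W : normedModType R) (br : bracket R)
    (X : vec R) (phi : vec R -> W) (p : vec R) : W :=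
  derive1 (fun s : R => phi (bch br p (s *: X))) 0.

(* Over the reals this is the usual notion of a C^oo function. *)
Fixpoint is_Cn (R : realType) (n : nat) (phi : vec R -> R) : Prop :=
  if n is n'.+1 then
    (forall p v, derivable phi p v) /\ (forall v, is_Cn n' (fun p => 'D_v phi p))
  else continuous phi.
Definition smooth (R : realType) (phi : vec R -> R) : Prop :=
  forall n, is_Cn n phi.
Definition csmooth (R : realType) (phi : vec R -> R[i]) : Prop :=
  smooth (fun p => complex.Re (phi p)) /\ smooth (fun p => complex.Im (phi p)).

(* K-valued k-forms on G, in the left trivialization of the tangent bundle:
   [al p X] is the value at p on the left-invariant fields X 0, ..., X k.-1.
   Left-invariant forms are those not depending on p; forms on the quotient
   Gam \ G are the forms on G with al (c * p) = al p for c in Gam. *)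
Definition dform (R : realType) (K : Type) (k : nat) : Type :=
  vec R -> ('I_k -> vec R) -> K.
Arguments dform R K k : clear implicits.

Definition descends (R : realType) (K : Type) (k : nat) (br : bracket R)
    (Gam : set (vec R)) (al : dform R K k) : Prop :=
  forall c, Gam c -> forall p X, al (bch br c p) X = al p X.

Definition wedge (R : realType) (K : fieldType) (k l : nat)
    (al : dform R K k) (be : dform R K l) : dform R K (k + l) :=
  fun p X => (k`! * l`!)%N%:R^-1 *
    \sum_(s : 'S_(k + l)) (-1) ^+ s *
      (al p (fun i => X (s (lshift l i))) * be p (fun j => X (s (rshift k j)))).

(* Exterior derivative. In the second sum [X_i, X_j] stands in position i
   instead of X_i (and X_j is omitted), whence the sign (-1)^j rather than
   (-1)^(i+j). *)
Definition ext_d (R : realType) (k : nat) (br : bracket R)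
    (al : dform R R k) : dform R R k.+1 :=
  fun p X =>
    \sum_(i < k.+1) (-1) ^+ i *
      ldiff br (X i) (fun q => al q (fun m => X (lift i m))) p
    + \sum_(i < k.+1) \sum_(j < k.+1 | (i < j)%N) (-1) ^+ j *
        al p (fun m => if lift j m == i then br (X i) (X j) else X (lift j m)).

Definition cext_d (R : realType) (k : nat) (br : bracket R)
    (al : dform R R[i] k) : dform R R[i] k.+1 :=
  fun p X => ext_d br (fun q Y => complex.Re (al q Y)) p X
          +i* ext_d br (fun q Y => complex.Im (al q Y)) p X.

Definition conj_form (R : realType) (k : nat) (al : dform R R[i] k) :
  dform R R[i] k := fun p X => (al p X)^*.

Definition zero_form (R : realType) (K : nmodType) (k : nat) : dform R K k :=
  fun _ _ => 0.
Arguments zero_form {R K k}.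

(* A basis e^1, ..., e^6 of 1-forms is given by an invertible matrix P whose
   columns are the e^k; the rows of invmx P are the dual basis E_1, ..., E_6.
   Indices k run from 1 to 6. *)
Definition ecoord (R : realType) (P : 'M[R]_6) (k : nat) (X : vec R) : R :=
  (X *m P) 0 (inord k.-1).
Definition frame (R : realType) (P : 'M[R]_6) (k : nat) : vec R :=
  row (inord k.-1) (invmx P).
Definition eform (R : realType) (P : 'M[R]_6) (k : nat) : dform R R 1 :=
  fun _ X => ecoord P k (X ord0).

(* h_6 = (0,0,0,0,12,13) *)
Definition is_h6 (R : realType) (br : bracket R) : Prop :=
  exists2 P : 'M[R]_6, P \in unitmx &
    [/\ forall k, (1 <= k <= 4)%N -> ext_d br (eform P k) =2 zero_form,
        ext_d br (eform P 5) =2 wedge (eform P 1) (eform P 2)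
      & ext_d br (eform P 6) =2 wedge (eform P 1) (eform P 3)].

(* Complex 1-forms omega^1, omega^2, omega^3 whose real and imaginary parts
   are the basis of real 1-forms given by the columns of W. *)
Definition omega (R : realType) (W : 'M[R]_6) (j : nat) : dform R R[i] 1 :=
  fun p X => eform W j.*2.-1 p X +i* eform W j.*2 p X.

Record is_complex_coframe (R : realType) (br : bracket R) (W : 'M[R]_6) :
    Prop := {
  omega_basis : W \in unitmx;
  omega_d1 : cext_d br (omega W 1) =2 zero_form;
  omega_d2 : cext_d br (omega W 2) =2 zero_form;
  omega_d3 : cext_d br (omega W 3) =2
    (fun p X => wedge (omega W 1) (omega W 2) p X
              - wedge (omega W 2) (conj_form (omega W 1)) p X) }.

Record is_adapted (R : realType) (t : R) (W P : 'M[R]_6) : Prop := {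
  adapted_basis : P \in unitmx;
  adapted12 : forall p X, eform P 1 p X +i* eform P 2 p X = omega W 1 p X;
  adapted34 : forall p X, eform P 3 p X +i* eform P 4 p X = omega W 2 p X;
  adapted56 : forall p X,
    eform P 5 p X +i* eform P 6 p X = t%:C * omega W 3 p X }.

Definition metric (R : realType) (P : 'M[R]_6) (X Y : vec R) : R :=
  \sum_(1 <= k < 7) ecoord P k X * ecoord P k Y.

(* J E_2 = E_1, J E_4 = E_3, J E_6 = E_5, J o J = - id *)
Definition cplxJ (R : realType) (P : 'M[R]_6) (X : vec R) : vec R :=
  ecoord P 2 X *: frame P 1 - ecoord P 1 X *: frame P 2
  + (ecoord P 4 X *: frame P 3 - ecoord P 3 X *: frame P 4)
  + (ecoord P 6 X *: frame P 5 - ecoord P 5 X *: frame P 6).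

Definition kaehler (R : realType) (P : 'M[R]_6) : dform R R 2 :=
  fun _ X => metric P (X ord0) (cplxJ P (X ord_max)).

Definition torsion (R : realType) (br : bracket R) (P : 'M[R]_6) : dform R R 3 :=
  fun p X => - ext_d br (kaehler P) p (fun m => cplxJ P (X m)).

(* e^1 /\ ... /\ e^6 *)
Definition volume (R : realType) (P : 'M[R]_6) (X : 'I_6 -> vec R) : R :=
  \det (\matrix_(i < 6, j < 6) ecoord P j.+1 (X i)).

(* Hodge star on 2-forms: ( *al )_{klmn} = 1/2 al^{ij} vol_{ijklmn}. *)
Definition hodge2 (R : realType) (P : 'M[R]_6) (al : dform R R 2) : dform R R 4 :=
  fun p X => 2^-1 * \sum_(1 <= i < 7) \sum_(1 <= j < 7)
    al p (tnth [tuple frame P i; frame P j]) *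
    volume P (tnth (cat_tuple [tuple frame P i; frame P j]
                              [tuple X m | m < 4])).

Definition balanced (R : realType) (br : bracket R) (P : 'M[R]_6) : Prop :=
  ext_d br (hodge2 P (kaehler P)) =2 zero_form.

(* A connection on the tangent bundle: [nab p X Y] is the value at p of
   nabla_X Y for left-invariant fields X and Y. *)
Definition connection (R : realType) : Type := vec R -> bracket R.

Definition preserves_metric (R : realType) (P : 'M[R]_6) (nab : connection R) :
    Prop :=
  forall p X Y Z, metric P (nab p X Y) Z + metric P Y (nab p X Z) = 0.

Definition preserves_J (R : realType) (P : 'M[R]_6) (nab : connection R) :
    Prop :=
  forall p X Y, nab p X (cplxJ P Y) = cplxJ P (nab p X Y).

Record is_levi_civita (R : realType) (br : bracket R) (P : 'M[R]_6)
    (nab : connection R) : Prop := {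
  lc_linear_l : forall p Y, linear (fun X => nab p X Y);
  lc_linear_r : forall p X, linear (nab p X);
  lc_metric : preserves_metric P nab;
  lc_torsion_free : forall p X Y, nab p X Y - nab p Y X = br X Y }.

(* nabla^+ *)
Definition is_bismut (R : realType) (br : bracket R) (P : 'M[R]_6)
    (nabg nabp : connection R) : Prop :=
  forall p X Y Z, metric P (nabp p X Y) Z =
    metric P (nabg p X Y) Z + 2^-1 * torsion br P p (tnth [tuple X; Y; Z]).

Definition cov_deriv (R : realType) (br : bracket R) (nab : connection R)
    (X : vec R) (Y : vec R -> vec R) : vec R -> vec R :=
  fun p => ldiff br X Y p + nab p X (Y p).

Definition curvature (R : realType) (br : bracket R) (nab : connection R)
    (p X Y Z : vec R) : vec R :=
  cov_deriv br nab X (fun q => nab q Y Z) p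
  - cov_deriv br nab Y (fun q => nab q X Z) p - nab p (br X Y) Z.

Definition curv_form (R : realType) (br : bracket R) (P : 'M[R]_6)
    (nab : connection R) (i j : nat) : dform R R 2 :=
  fun p X => metric P
    (curvature br nab p (X ord0) (X ord_max) (frame P j)) (frame P i).

Definition p1_conn (R : realType) (br : bracket R) (P : 'M[R]_6)
    (nab : connection R) : dform R R 4 :=
  fun p X => (8 * pi ^+ 2)^-1 *
    \sum_(1 <= j < 7) \sum_(1 <= i < j)
      wedge (curv_form br P nab i j) (curv_form br P nab i j) p X.

(* Since J, g are parallel the holonomy lies in u(3); it is in su(3) exactly
   when the Ricci form vanishes. *)
Record hol_in_su3 (R : realType) (br : bracket R) (P : 'M[R]_6)
    (nab : connection R) : Prop := {
  hol_metric : preserves_metric P nab;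
  hol_J : preserves_J P nab;
  hol_ricci : forall p X Y,
    \sum_(1 <= i < 7)
      metric P (curvature br nab p X Y (cplxJ P (frame P i))) (frame P i) = 0 }.

(* A U(1)-bundle with connection on Gam \ G: since G is contractible, its
   pull-back to G is trivial with connection d + i a, a real 1-form, and the
   bundle is recovered from the U(1)-valued transition functions u c of the
   deck transformations c in Gam (sections are s with s (c p) = u c p * s p).
   The curvature is i da, that is the real 2-form da under u(1) = so(2) = R. *)
Record u1_connection (R : realType) (br : bracket R) (Gam : set (vec R)) :
    Type := U1Connection {
  potential : dform R R 1;
  transition : vec R -> vec R -> R[i];
  potential_linear : forall p, linear (fun X : vec R => potential p (fun=> X) : R^o);
  potential_smooth : forall X, smooth (fun p => potential p X);
  transition_smooth : forall c, Gam c -> csmooth (transition c);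
  transition_unitary : forall c, Gam c -> forall p, `|transition c p| = 1;
  transition_cocycle : forall c c', Gam c -> Gam c' -> forall p,
    transition (bch br c c') p =
    transition c (bch br c' p) * transition c' p;
  transition_connection : forall c, Gam c -> forall p (X : 'I_1 -> vec R),
    cext_d br (fun q (_ : 'I_0 -> vec R) => transition c q) p X =
    - 'i * (potential (bch br c p) X - potential p X)%:C * transition c p }.

Definition u1_curvature (R : realType) (br : bracket R) (Gam : set (vec R))
    (A : u1_connection br Gam) : dform R R 2 := ext_d br (potential A).

Definition p1_u1 (R : realType) (br : bracket R) (Gam : set (vec R))
    (A : u1_connection br Gam) : dform R R 4 :=
  fun p X => (8 * pi ^+ 2)^-1 * wedge (u1_curvature A) (u1_curvature A) p X.

Definition su3_instanton (R : realType) (br : bracket R) (P : 'M[R]_6)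
    (Gam : set (vec R)) (A : u1_connection br Gam) : Prop :=
  (forall p X, u1_curvature A p (fun m => cplxJ P (X m)) = u1_curvature A p X)
  /\ (forall p, \sum_(1 <= k < 7)
        u1_curvature A p (tnth [tuple frame P k; cplxJ P (frame P k)]) = 0).

Definition cderive1 (R : realType) (h : R -> R[i]) (s : R) : R[i] :=
  derive1 (fun r => complex.Re (h r)) s +i* derive1 (fun r => complex.Im (h r)) s.

(* d/dz = 1/2 (d/dx - i d/dy) *)
Definition wirtinger (R : realType) (h : R[i] -> R[i]) (z : R[i]) : R[i] :=
  2^-1 * (cderive1 (fun s => h (z + s%:C)) 0
          - 'i * cderive1 (fun s => h (z + 'i * s%:C)) 0).

(* e^{i gam} sqrt (1/4 - f^2) *)
Definition offdiag (R : realType) (f gam : R) : R[i] :=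
  (cos gam +i* sin gam) * (Num.sqrt (4^-1 - f ^+ 2))%:C.

(* The abelian instanton: z1, z2 : G -> C are functions with dz_j = omega^j. *)
Record is_abelian_instanton (R : realType) (br : bracket R)
    (Gam : set (vec R)) (W : 'M[R]_6) (z1 z2 : vec R -> R[i])
    (f gam : R[i] -> R[i] -> R) (A : u1_connection br Gam) : Prop := {
  inst_smooth : csmooth z1 /\ csmooth z2;
  inst_dz1 : cext_d br (fun p (_ : 'I_0 -> vec R) => z1 p) =2 omega W 1;
  inst_dz2 : cext_d br (fun p (_ : 'I_0 -> vec R) => z2 p) =2 omega W 2;
  inst_bound : forall x y, `|f x y| <= 2^-1;
  inst_curvature : forall p X,
    (u1_curvature A p X)%:C =
      'i * (f (z1 p) (z2 p))%:C
         * wedge (omega W 1) (conj_form (omega W 1)) p X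
      - 'i * (f (z1 p) (z2 p))%:C
         * wedge (omega W 2) (conj_form (omega W 2)) p X
      + offdiag (f (z1 p) (z2 p)) (gam (z1 p) (z2 p))
         * wedge (omega W 1) (conj_form (omega W 2)) p X
      - offdiag (f (z1 p) (z2 p)) (- gam (z1 p) (z2 p))
         * wedge (omega W 2) (conj_form (omega W 1)) p X;
  inst_descends : descends br Gam (u1_curvature A);
  inst_eq1 : forall x y,
    'i * wirtinger (fun y' => (f x y')%:C) y
    + wirtinger (fun x' => offdiag (f x' y) (- gam x' y)) x = 0;
  inst_eq2 : forall x y,
    'i * wirtinger (fun x' => (f x' y)%:C) x
    + wirtinger (fun y' => offdiag (f x y') (gam x y')) y = 0 }.

Record heterotic_susy (R : realType) (br : bracket R) (Gam : set (vec R))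
    (P : 'M[R]_6) (nabp : connection R) (A : u1_connection br Gam) : Prop := {
  susy_gravitino : hol_in_su3 br P nabp;
  susy_dilatino : balanced br P;
  susy_gaugino : su3_instanton P A }.

(* dT = alpha'/4 8 pi^2 (p_1(nab) - p_1(A)) for some alpha' > 0 *)
Definition bianchi_identity (R : realType) (br : bracket R)
    (Gam : set (vec R)) (P : 'M[R]_6) (nab : connection R)
    (A : u1_connection br Gam) : Prop :=
  exists2 alpha' : R, 0 < alpha' & forall p X,
    ext_d br (torsion br P) p X =
    alpha' / 4 * (8 * pi ^+ 2) * (p1_conn br P nab p X - p1_u1 A p X).

(* Main.v *)
Require Import Defs.
From mathcomp Require Import all_boot all_order all_fingroup all_algebra.
From mathcomp Require Import complex ring.
From mathcomp Require Import all_classical all_reals all_analysis.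
Import Order.TTheory GRing.Theory Num.Theory.
Import numFieldNormedType.Exports.
Local Open Scope classical_set_scope.
Local Open Scope ring_scope.
Local Open Scope complex_scope.

Set Implicit Arguments.
Unset Strict Implicit.
Unset Printing Implicit Defensive.

(** Write e^{ij..} for the exterior products of the adapted coframe. Since the
metric, the complex structure and the bracket are left-invariant, everything
but the gauge field has constant coefficients in this frame, and the theorem
is an identity between multiples of one 4-form, e^{1234}.

The equation for d omega^3 amounts to [E_1,E_3] = -2t E_5 and
[E_1,E_4] = -2t E_6, all other brackets of frame fields being zero
([bracketE]). Hence dF = 2t (e^{136} - e^{145}), and applying J gives
T = 2t (e^{245} - e^{236}), which is not zero, and
dT = -8 t^2 e^{1234} ([torsionE], [ext_d_torsion]). The Koszul formula then
determines nabla^+ ([bismutE]) and its curvature ([curv_formE]). In the sum of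
the squares of the curvature forms the terms in e^{1256} and e^{3456} cancel,
and what is left is -16 t^4 e^{1234} ([sum_curvature_squares]); the same
formulas show that J is parallel and that the Ricci form vanishes
([hol_in_su3_bismut]).

The functions f, gamma of the instanton enter at each point only through
u = f and a + i b = e^{i gamma} sqrt (1/4 - f^2): the curvature is a combination
2 (u s_1 + a s_2 + b s_3) of the three anti-self-dual forms
s_1 = e^{12} - e^{34}, s_2 = e^{13} + e^{24}, s_3 = e^{14} - e^{23}. These are
J-invariant and trace-free, whence the instanton condition, and they satisfy
s_i /\ s_j = -2 delta_{ij} e^{1234}. As u^2 + a^2 + b^2 = 1/4, the square of the
curvature is the constant form -2 e^{1234} ([instanton_curvatureE],
[p1_u1E]).

Therefore 8 pi^2 (p_1(nabla^+) - p_1(A)) = -(16 t^4 - 2) e^{1234}, to be compared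
with dT = -8 t^2 e^{1234}: the ratio is 4 t^2 / (8 t^4 - 1), which is alpha'/4,
and it is positive exactly for 8 t^4 > 1. Finally, the metric is balanced
because the star of F is F /\ F / 2 ([hodge_kaehler]), whose differential
F /\ dF vanishes: each of e^{136} and e^{145} has a factor in common with each
of e^{12}, e^{34} and e^{56} ([balanced_h6]). *)

(** * Exterior products and derivatives in low degree *)

(** Values of a permutation on 0, 1, 2, ... are read off [lift_perm], so
iterating this recursion turns the sum over permutations in the definition of
the wedge product into an explicit one. *)
Lemma sum_perm_recl (V : nmodType) n (F : 'S_n.+1 -> V) :
  \sum_s F s = \sum_(j < n.+1) \sum_(s : 'S_n) F (lift_perm ord0 j s).
Proof.
rewrite pair_big /=.
apply: (reindex (fun u : 'I_n.+1 * 'S_n => lift_perm ord0 u.1 u.2)).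
apply: onW_bij; apply: inj_card_bij; last by rewrite card_prod card_ord !card_Sn factS.
move=> [j s] [k r] /= /permP eq_jk.
have := eq_jk ord0; rewrite !lift_perm_id => jk; rewrite jk in eq_jk *.
congr (_, _); apply/permP => i; have := eq_jk (lift ord0 i).
by rewrite !lift_perm_lift => /lift_inj.
Qed.

Lemma sum_perm0 (V : nmodType) (F : 'S_0 -> V) : \sum_s F s = F 1%g.
Proof.
rewrite (bigD1 1%g) //= big1 ?addr0 // => s; case/eqP.
by apply/permP => -[].
Qed.

Lemma wedge11E (R : realType) (K : fieldType) (al be : dform R K 1) p X :
  wedge al be p X = al p (fun=> X ord0) * be p (fun=> X ord_max)
                  - al p (fun=> X ord_max) * be p (fun=> X ord0).
Proof.
rewrite /wedge invr1 mul1r.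
rewrite (eq_bigr (fun s : 'S_2 => (-1) ^+ s *
  (al p (fun=> X (s ord0)) * be p (fun=> X (s (lift ord0 ord0)))))); last first.
  move=> s _.
  have E (Y : 'I_1 -> vec R) : Y = fun=> Y ord0 by apply/funext => i; rewrite ord1.
  rewrite [X in al p X]E [X in be p X]E.
  have -> : lshift 1 (ord0 : 'I_1) = ord0 by exact: val_inj.
  by have -> : rshift 1 (ord0 : 'I_1) = lift ord0 ord0 by exact: val_inj.
rewrite sum_perm_recl !big_ord_recl big_ord0 !sum_perm_recl !big_ord_recl !big_ord0.
rewrite !sum_perm0 !lift_perm_lift !lift_perm_id !odd_lift_perm /= odd_perm1 /= !addr0.
have -> : ord_max = lift ord0 ord0 :> 'I_(1 + 1) by exact: val_inj.
have -> : lift (lift ord0 ord0) ord0 = ord0 :> 'I_2 by exact: val_inj.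
by rewrite expr0 expr1 mul1r mulN1r.
Qed.

(** Numbering the arguments of a form by natural numbers lets the indices
produced by lifts of ordinals be evaluated to numerals. *)
Definition args (R : realType) k (X : 'I_k.+1 -> vec R) (i : nat) : vec R :=
  X (inord i).

Lemma argsE (R : realType) k (X : 'I_k.+1 -> vec R) i : X i = args X i.
Proof. by rewrite /args inord_val. Qed.

Definition ext11 (R : realType) (a b : vec R -> R) (x y : vec R) : R :=
  a x * b y - b x * a y.

Definition ext22 (R : realType) (a b : vec R -> vec R -> R) (x y z w : vec R) : R :=
  a x y * b z w - a x z * b y w + a x w * b y z
  + a y z * b x w - a y w * b x z + a z w * b x y.

(** Skew-symmetry groups the 24 permutations by fours, which cancels the factor
1 / (2! 2!) and leaves the six shuffles. *)
Lemma wedge22E (R : realType) (al be : dform R R 2) a b p X :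
    (forall Y, al p Y = a (args Y 0) (args Y 1)) ->
    (forall Y, be p Y = b (args Y 0) (args Y 1)) ->
    (forall x y, a x y = - a y x) -> (forall x y, b x y = - b y x) ->
  wedge al be p X =
    let x := args (X : 'I_4 -> vec R) in ext22 a b (x 0%N) (x 1%N) (x 2%N) (x 3%N).
Proof.
move=> alE beE aN bN.
pose c0 : 'I_4 := ord0.
pose c1 : 'I_4 := lift ord0 ord0.
pose c2 : 'I_4 := lift ord0 (lift ord0 ord0).
pose c3 : 'I_4 := lift ord0 (lift ord0 (lift ord0 ord0)).
rewrite /wedge (eq_bigr (fun s : 'S_4 => (-1) ^+ s *
  (a (X (s c0)) (X (s c1)) * b (X (s c2)) (X (s c3))))); last first.
  move=> s _; rewrite alE beE /args.
  have -> : lshift 2 (inord 0 : 'I_2) = c0 by apply: val_inj; rewrite /= inordK.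
  have -> : lshift 2 (inord 1 : 'I_2) = c1 by apply: val_inj; rewrite /= inordK.
  have -> : rshift 2 (inord 0 : 'I_2) = c2 by apply: val_inj; rewrite /= inordK.
  by have -> : rshift 2 (inord 1 : 'I_2) = c3 by apply: val_inj; rewrite /= inordK.
rewrite /c0 /c1 /c2 /c3.
do 4!(rewrite ?sum_perm_recl ?big_ord_recl ?big_ord0 ?addr0).
rewrite !sum_perm0 !lift_perm_lift !lift_perm_id !odd_lift_perm /= odd_perm1 /=.
rewrite !(@argsE _ 3) /= /bump /= !add1n.
rewrite /ext22.
move: (args X 0) (args X 1) (args X 2) (args X 3) => x y z w.
rewrite (aN z w) (aN y w) (aN y z) (aN x w) (aN x z) (aN x y).
rewrite (bN z w) (bN y w) (bN y z) (bN x w) (bN x z) (bN x y).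
rewrite expr0 expr1 (_ : (2`! * 2`!)%N = 4) //.
by field.
Qed.

(** The derivative terms vanish on forms with constant coefficients, so d is
the Chevalley-Eilenberg differential of the Lie algebra. *)
Lemma ext_d_invariant (R : realType) (br : bracket R) k (al : dform R R k) p X :
    (forall q Y, al q Y = al 0 Y) ->
  ext_d br al p X = \sum_(i < k.+1) \sum_(j < k.+1 | (i < j)%N) (-1) ^+ j *
    al p (fun m => if lift j m == i then br (X i) (X j) else X (lift j m)).
Proof.
move=> al0; rewrite /ext_d big1 ?add0r // => i _.
rewrite /ldiff (_ : (fun s : R => _) = cst (al 0 (fun m => X (lift i m)))).
  by rewrite derive1_cst mulr0.
by apply/funext => s; rewrite al0.
Qed.

Lemma inord_ord0 n : inord 0 = ord0 :> 'I_n.+1.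
Proof. by apply: val_inj; rewrite /= inordK. Qed.

Lemma inord_lift n k : (k < n.+1)%N -> inord k.+1 = lift ord0 (inord k) :> 'I_n.+2.
Proof. by move=> kn; apply: val_inj; rewrite /= !inordK. Qed.

Ltac expand_ext_d alE :=
  rewrite ext_d_invariant => [|? ?]; last (by rewrite !alE);
  under eq_bigr do rewrite big_mkcond;
  rewrite !big_ord_recl !big_ord0 /= !addr0 !alE [in LHS]/args;
  rewrite ?inord_lift // !inord_ord0 -!val_eqE /= !argsE /= /bump /= !add1n.

Section ExtD.
Variables (R : realType) (br : bracket R).

Lemma ext_d1E (al : dform R R 1) (a : vec R -> R) p (X : _ -> vec R) :
    (forall q Y, al q Y = a (args Y 0)) ->
  ext_d br al p X = - a (br (args X 0) (args X 1)).
Proof. by move=> alE; expand_ext_d alE; ring. Qed.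

Lemma ext_d2E (al : dform R R 2) (a : vec R -> vec R -> R) p (X : _ -> vec R) :
    (forall q Y, al q Y = a (args Y 0) (args Y 1)) ->
  ext_d br al p X = - a (br (args X 0) (args X 1)) (args X 2)
   + a (br (args X 0) (args X 2)) (args X 1)
   + a (args X 0) (br (args X 1) (args X 2)).
Proof. by move=> alE; expand_ext_d alE; ring. Qed.

Lemma ext_d3E (al : dform R R 3) (a : vec R -> vec R -> vec R -> R) p (X : _ -> vec R) :
    (forall q Y, al q Y = a (args Y 0) (args Y 1) (args Y 2)) ->
  ext_d br al p X =
   - a (br (args X 0) (args X 1)) (args X 2) (args X 3)
   + a (br (args X 0) (args X 2)) (args X 1) (args X 3)
   - a (br (args X 0) (args X 3)) (args X 1) (args X 2)
   + a (args X 0) (br (args X 1) (args X 2)) (args X 3)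
   - a (args X 0) (br (args X 1) (args X 3)) (args X 2)
   - a (args X 0) (args X 1) (br (args X 2) (args X 3)).
Proof. by move=> alE; expand_ext_d alE; ring. Qed.

Lemma ext_d4E (al : dform R R 4) (a : vec R -> vec R -> vec R -> vec R -> R) p
    (X : _ -> vec R) :
    (forall q Y, al q Y = a (args Y 0) (args Y 1) (args Y 2) (args Y 3)) ->
  ext_d br al p X =
   - a (br (args X 0) (args X 1)) (args X 2) (args X 3) (args X 4)
   + a (br (args X 0) (args X 2)) (args X 1) (args X 3) (args X 4)
   - a (br (args X 0) (args X 3)) (args X 1) (args X 2) (args X 4)
   + a (br (args X 0) (args X 4)) (args X 1) (args X 2) (args X 3)
   + a (args X 0) (br (args X 1) (args X 2)) (args X 3) (args X 4)
   - a (args X 0) (br (args X 1) (args X 3)) (args X 2) (args X 4)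
   + a (args X 0) (br (args X 1) (args X 4)) (args X 2) (args X 3)
   - a (args X 0) (args X 1) (br (args X 2) (args X 3)) (args X 4)
   + a (args X 0) (args X 1) (br (args X 2) (args X 4)) (args X 3)
   + a (args X 0) (args X 1) (args X 2) (br (args X 3) (args X 4)).
Proof. by move=> alE; expand_ext_d alE; ring. Qed.
End ExtD.

Lemma det_delta_row (R : comPzRingType) n (M : 'M[R]_n.+1) (j : 'I_n.+1) :
    (forall k, M ord0 k = (k == j)%:R) ->
  \det M = (-1) ^+ j * \det (row' ord0 (col' j M)).
Proof.
move=> M0; rewrite (expand_det_row _ ord0) (bigD1 j) //= big1 => [|k /negbTE kj].
  by rewrite M0 eqxx mul1r addr0 /cofactor add0n.
by rewrite M0 kj mul0r.
Qed.

(** Laplace expansion of a 4 x 4 determinant along its first two columns. *)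
Lemma det_ext22 (R : realType) (c : nat -> vec R -> R) (X : 'I_4 -> vec R) :
  \det (\matrix_(k < 4, l < 4) c l (X k)) =
    ext22 (ext11 (c 0%N) (c 1%N)) (ext11 (c 2%N) (c 3%N))
      (args X 0) (args X 1) (args X 2) (args X 3).
Proof.
rewrite (expand_det_row _ ord0) !big_ord_recl big_ord0 /cofactor.
rewrite !(expand_det_row (_ : 'M[R]_3) ord0) !big_ord_recl !big_ord0 /cofactor.
rewrite !(expand_det_row (_ : 'M[R]_2) ord0) !big_ord_recl !big_ord0 /cofactor.
rewrite !det_mx11 !mxE !argsE /= /bump /= !add1n /ext22 /ext11.
move: (args X 0) (args X 1) (args X 2) (args X 3) => x y z w.
by ring.
Qed.

(** * Coordinates in a frame *)

Section Frame.
Variables (R : realType) (P : 'M[R]_6).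
Hypothesis P_unit : P \in unitmx.
Implicit Types (X Y Z : vec R) (k : nat).

Lemma ecoordD k X Y : ecoord P k (X + Y) = ecoord P k X + ecoord P k Y.
Proof. by rewrite /ecoord mulmxDl mxE. Qed.

Lemma ecoordN k X : ecoord P k (- X) = - ecoord P k X.
Proof. by rewrite /ecoord mulNmx mxE. Qed.

Lemma ecoordZ k a X : ecoord P k (a *: X) = a * ecoord P k X.
Proof. by rewrite /ecoord -scalemxAl mxE. Qed.

Lemma ecoord_frame j k : (0 < j < 7)%N -> (0 < k < 7)%N ->
  ecoord P k (frame P j) = (j == k)%:R.
Proof.
move=> /andP[j_gt0 j_lt7] /andP[k_gt0 k_lt7].
rewrite /ecoord /frame -row_mul mulVmx // !mxE -val_eqE /=.
rewrite !inordK ?prednK //; congr ((_ : bool)%:R).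
by rewrite -eqSS !prednK.
Qed.

Lemma ecoord_inj X Y :
  (forall k, (0 < k < 7)%N -> ecoord P k X = ecoord P k Y) -> X = Y.
Proof.
move=> eqXY; apply: (can_inj (mulmxK P_unit)); apply/rowP => i.
by have := eqXY i.+1; rewrite /ecoord /= inord_val; apply; rewrite /= ltnS.
Qed.

Lemma metricE X Y : metric P X Y =
  ecoord P 1 X * ecoord P 1 Y + ecoord P 2 X * ecoord P 2 Y +
  ecoord P 3 X * ecoord P 3 Y + ecoord P 4 X * ecoord P 4 Y +
  ecoord P 5 X * ecoord P 5 Y + ecoord P 6 X * ecoord P 6 Y.
Proof.
rewrite /metric; do 6!(rewrite big_ltn; last by []); rewrite big_geq; last by [].
by rewrite addr0 !addrA.
Qed.

Lemma metric_frame k X : (0 < k < 7)%N -> metric P X (frame P k) = ecoord P k X.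
Proof.
case: k => [|[|[|[|[|[|[|k]]]]]]] // _; rewrite metricE !ecoord_frame //=; ring.
Qed.

(** Stated, like the other coordinate formulas below, as a product of equations
so that it can be used as a rewriting rule for all coordinates at once. *)
Lemma ecoord_cplxJ X :
  ((ecoord P 1 (cplxJ P X) = ecoord P 2 X) *
   (ecoord P 2 (cplxJ P X) = - ecoord P 1 X) *
   (ecoord P 3 (cplxJ P X) = ecoord P 4 X) *
   (ecoord P 4 (cplxJ P X) = - ecoord P 3 X) *
   (ecoord P 5 (cplxJ P X) = ecoord P 6 X) *
   (ecoord P 6 (cplxJ P X) = - ecoord P 5 X))%type.
Proof.
by do !split; rewrite /cplxJ !(ecoordD, ecoordN, ecoordZ) !ecoord_frame //=; ring.
Qed.

Lemma koszul (br : bracket R) (nabg : connection R) p X Y Z : is_levi_civita br P nabg ->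
  2 * metric P (nabg p X Y) Z =
    metric P (br X Y) Z - metric P (br Y Z) X + metric P (br Z X) Y.
Proof.
case=> _ _ mc tf.
have mB U V S : metric P (U - V) S = metric P U S - metric P V S.
  by rewrite !metricE !(ecoordD, ecoordN); move: (ecoord P) => f; ring.
have mC U V : metric P U V = metric P V U.
  by rewrite !metricE; move: (ecoord P) => f; ring.
have skew U V S : metric P (nabg p U V) S = - metric P (nabg p U S) V.
  by apply/eqP; rewrite -subr_eq0 opprK [metric P _ V]mC mc.
rewrite -!(tf p) !mB (skew Y X Z) (skew X Z Y) (skew Z Y X); ring.
Qed.

(** The volume form contracted with two frame vectors: these fill the first two
rows with unit vectors, and deleting them leaves the complementary minor. *)
Lemma volume_frames (X : 'I_4 -> vec R) (i : 'I_6) (j : 'I_5) :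
  volume P (tnth (cat_tuple [tuple frame P i.+1; frame P (lift i j).+1]
                            [tuple X m | m < 4])) =
  (-1) ^+ (i + j) * \det (\matrix_(k < 4, l < 4) ecoord P (lift i (lift j l)).+1 (X k)).
Proof.
have bd (k : 'I_6) : (0 < k.+1 < 7)%N by rewrite /= ltnS.
rewrite /volume (det_delta_row (j := i)); last first.
  by move=> k; rewrite mxE (tnth_nth 0) ecoord_frame // eqSS eq_sym.
rewrite (det_delta_row (j := j)); last first.
  move=> k; rewrite !mxE (tnth_nth 0) ecoord_frame // eqSS.
  by rewrite (inj_eq val_inj) (inj_eq lift_inj) eq_sym.
rewrite mulrA -exprD; congr (_ * \det _); apply/matrixP => k l; rewrite !mxE.
have -> : lift ord0 (lift ord0 k) = rshift 2 k by exact: val_inj.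
by rewrite tnth_rshift tnth_mktuple.
Qed.

Definition plane (i j : nat) : vec R -> vec R -> R :=
  ext11 (ecoord P i) (ecoord P j).

Lemma planeN i j x y : plane i j x y = - plane i j y x.
Proof. by rewrite /plane /ext11; ring. Qed.

Definition e1234 (X : 'I_4 -> vec R) : R :=
  ext22 (plane 1 2) (plane 3 4) (args X 0) (args X 1) (args X 2) (args X 3).

End Frame.

(** * The torsion and its differential *)

Section BalancedStructure.
Variables (R : realType) (br : bracket R) (W P : 'M[R]_6) (t : R).
Hypotheses (W_coframe : is_complex_coframe br W) (P_adapted : is_adapted t W P).

Notation e := (ecoord P).
Notation e_ i j := (plane P i j).
Let P_unit : P \in unitmx := adapted_basis P_adapted.
Let jE := ecoord_cplxJ P_unit.

Lemma ecoord_adapted X :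
  [/\ ecoord P 1 X = ecoord W 1 X, ecoord P 2 X = ecoord W 2 X,
      ecoord P 3 X = ecoord W 3 X & ecoord P 4 X = ecoord W 4 X] /\
  (ecoord P 5 X = t * ecoord W 5 X /\ ecoord P 6 X = t * ecoord W 6 X).
Proof.
have [_ h12 h34 h56] := P_adapted.
have [e1 e2] := h12 0 (fun=> X).
have [e3 e4] := h34 0 (fun=> X).
have e5 := congr1 (@complex.Re R) (h56 0 (fun=> X)).
have e6 := congr1 (@complex.Im R) (h56 0 (fun=> X)).
rewrite /= mul0r subr0 in e5; rewrite /= mul0r addr0 in e6.
by do !split.
Qed.

Lemma ext_d_eform k p X :
  ext_d br (eform W k) p X = - ecoord W k (br (args X 0) (args X 1)).
Proof. by apply: ext_d1E => q Y; rewrite /eform /args inord_ord0. Qed.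

(** Here d e^k (X, Y) = - e^k [X, Y], and omega^{12} - omega^{2 bar 1} =
2 e^1 /\ (e^3 + i e^4). *)
Lemma bracketE X Y :
  ((e 1 (br X Y) = 0) * (e 2 (br X Y) = 0) *
   (e 3 (br X Y) = 0) * (e 4 (br X Y) = 0) *
   (e 5 (br X Y) = (- (2 * t) * (e 1 X * e 3 Y - e 3 X * e 1 Y))%R) *
   (e 6 (br X Y) = (- (2 * t) * (e 1 X * e 4 Y - e 4 X * e 1 Y))%R))%type.
Proof.
have [_ d1 d2 d3] := W_coframe.
pose U : 'I_2 -> vec R := tnth [tuple X; Y].
have U0 : args U 0 = X by rewrite /args /U (tnth_nth 0) inordK.
have U1 : args U 1 = Y by rewrite /args /U (tnth_nth 0) inordK.
have deq k : ext_d br (eform W k) 0 U = - ecoord W k (br X Y).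
  by rewrite ext_d_eform U0 U1.
have re (z z' : R[i]) : z = z' -> complex.Re z = complex.Re z' by move->.
have im (z z' : R[i]) : z = z' -> complex.Im z = complex.Im z' by move->.
have e1 : ext_d br (eform W 1) 0 U = 0 := re _ _ (d1 0 U).
have e2 : ext_d br (eform W 2) 0 U = 0 := im _ _ (d1 0 U).
have e3 : ext_d br (eform W 3) 0 U = 0 := re _ _ (d2 0 U).
have e4 : ext_d br (eform W 4) 0 U = 0 := im _ _ (d2 0 U).
have e5 : ext_d br (eform W 5) 0 U = _ := re _ _ (d3 0 U).
have e6 : ext_d br (eform W 6) 0 U = _ := im _ _ (d3 0 U).
have [[b1 b2 b3 b4] [b5 b6]] := ecoord_adapted (br X Y).
have [[-> _ -> ->] _] := ecoord_adapted X.
have [[-> _ -> ->] _] := ecoord_adapted Y.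
rewrite !deq !wedge11E in e1 e2 e3 e4 e5 e6.
rewrite /conj_form /omega /eform /= in e5 e6.
have UX : U ord0 = X by [].
have UY : U ord_max = Y by [].
rewrite UX UY /double /= in e5 e6.
rewrite b1 b2 b3 b4 b5 b6 -[ecoord W 5 _]opprK -[ecoord W 6 _]opprK e5 e6.
do !split; try (by apply/oppr_inj; rewrite oppr0); ring.
Qed.

Definition kaehler_form (x y : vec R) : R :=
  e_ 1 2 x y + e_ 3 4 x y + e_ 5 6 x y.

Lemma kaehlerE p (X : 'I_2 -> vec R) :
  kaehler P p X = kaehler_form (args X 0) (args X 1).
Proof.
rewrite /kaehler /kaehler_form metricE.
rewrite !jE !argsE /plane /ext11 /=; move: (ecoord P) => f; ring.
Qed.

(** 2t (e^{245} - e^{236}) *)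
Definition torsion_form (x y z : vec R) : R :=
  2 * t * (e 2 x * e_ 4 5 y z - e 2 y * e_ 4 5 x z + e 2 z * e_ 4 5 x y
         - (e 2 x * e_ 3 6 y z - e 2 y * e_ 3 6 x z + e 2 z * e_ 3 6 x y)).

Lemma torsionE p (X : 'I_3 -> vec R) :
  torsion br P p X = torsion_form (args X 0) (args X 1) (args X 2).
Proof.
rewrite /torsion (ext_d2E _ _ _ kaehlerE) /kaehler_form /plane /ext11 /args /=.
move: (X (inord 0)) (X (inord 1)) (X (inord 2)) => x y z.
rewrite !bracketE !jE /torsion_form /plane /ext11; move: (ecoord P) => f; ring.
Qed.

Lemma ext_d_torsion p (X : 'I_4 -> vec R) :
  ext_d br (torsion br P) p X = - (8 * t ^+ 2) * e1234 P X.
Proof.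
rewrite (ext_d3E _ _ _ torsionE) /e1234 /ext22.
move: (args X 0) (args X 1) (args X 2) (args X 3) => x y z w.
rewrite /torsion_form /plane /ext11 !bracketE.
move: (ecoord P) => f; ring.
Qed.

(** * The Bismut-Strominger connection *)

Variables (nabg nabp : connection R).
Hypotheses (nabg_lc : is_levi_civita br P nabg)
  (nabp_bismut : is_bismut br P nabg nabp).

Lemma ecoord_bismut p X Y k : (0 < k < 7)%N -> e k (nabp p X Y) =
  2^-1 * (metric P (br X Y) (frame P k) - metric P (br Y (frame P k)) X
          + metric P (br (frame P k) X) Y + torsion_form X Y (frame P k)).
Proof.
move=> k_bd; rewrite -metric_frame // nabp_bismut torsionE.
rewrite -(koszul p X Y (frame P k) nabg_lc).
by rewrite /args !(tnth_nth 0) !inordK //=; field.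
Qed.

Lemma bismutE p X Y :
  ((e 1 (nabp p X Y) =
      (- t * (e 3 X * e 5 Y + e 4 X * e 6 Y + e 5 X * e 3 Y + e 6 X * e 4 Y))%R) *
   (e 2 (nabp p X Y) =
      (- t * (e 3 X * e 6 Y - e 4 X * e 5 Y + e 5 X * e 4 Y - e 6 X * e 3 Y))%R) *
   (e 3 (nabp p X Y) =
      (t * (e 1 X * e 5 Y + e 2 X * e 6 Y + e 5 X * e 1 Y - e 6 X * e 2 Y))%R) *
   (e 4 (nabp p X Y) =
      (t * (e 1 X * e 6 Y - e 2 X * e 5 Y + e 5 X * e 2 Y + e 6 X * e 1 Y))%R) *
   (e 5 (nabp p X Y) =
      (- t * (e 1 X * e 3 Y - e 2 X * e 4 Y - e 3 X * e 1 Y + e 4 X * e 2 Y))%R) *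
   (e 6 (nabp p X Y) =
      (- t * (e 1 X * e 4 Y + e 2 X * e 3 Y - e 3 X * e 2 Y - e 4 X * e 1 Y))%R))%type.
Proof.
do !split; rewrite ecoord_bismut // !metric_frame // !metricE;
  rewrite /torsion_form /plane /ext11 !bracketE !ecoord_frame //=;
  move: (ecoord P) => f; by field.
Qed.

(** The Koszul formula forces the coefficients of nabla^+ in a left-invariant
frame to be the same at all points, so their derivatives vanish. *)
Lemma curvatureE p X Y Z : curvature br nabp p X Y Z =
  nabp 0 X (nabp 0 Y Z) - nabp 0 Y (nabp 0 X Z) - nabp 0 (br X Y) Z.
Proof.
have const q U V : nabp q U V = nabp 0 U V.
  apply: (ecoord_inj P_unit) => k k_bd; by rewrite !ecoord_bismut.
rewrite /curvature /cov_deriv /ldiff.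
rewrite (_ : (fun s : R => _) = cst (nabp 0 Y Z)); last first.
  by apply/funext => s; rewrite const.
rewrite derive1_cst add0r.
rewrite (_ : (fun s : R => _) = cst (nabp 0 X Z)); last first.
  by apply/funext => s; rewrite const.
by rewrite derive1_cst add0r !(const p).
Qed.

(** The curvature forms above the diagonal. That they take values in su(3) shows
in the coincidences between the entries (1,3) and (2,4), say, and in the sum of
the entries (1,2), (3,4) and (5,6), which is zero. *)
Definition bismut_curvature (i j : nat) (x y : vec R) : R :=
  t ^+ 2 * match i, j with
  | 1, 2 => 2 * (e_ 3 4 x y + e_ 5 6 x y)
  | 1, 3 => - (3 * e_ 1 3 x y + e_ 2 4 x y)
  | 2, 3 => 3 * e_ 1 4 x y - e_ 2 3 x y
  | 1, 4 => - (3 * e_ 1 4 x y - e_ 2 3 x y)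
  | 2, 4 => - (3 * e_ 1 3 x y + e_ 2 4 x y)
  | 3, 4 => 2 * (e_ 1 2 x y - e_ 5 6 x y)
  | 1, 5 => e_ 1 5 x y - e_ 2 6 x y
  | 2, 5 => - (e_ 1 6 x y + e_ 2 5 x y)
  | 3, 5 => e_ 3 5 x y + e_ 4 6 x y
  | 4, 5 => e_ 3 6 x y - e_ 4 5 x y
  | 1, 6 => e_ 1 6 x y + e_ 2 5 x y
  | 2, 6 => e_ 1 5 x y - e_ 2 6 x y
  | 3, 6 => - (e_ 3 6 x y - e_ 4 5 x y)
  | 4, 6 => e_ 3 5 x y + e_ 4 6 x y
  | 5, 6 => - (2 * (e_ 1 2 x y + e_ 3 4 x y))
  | _, _ => 0
  end.

Lemma curv_formE i j p X : (0 < i < j)%N -> (j < 7)%N ->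
  curv_form br P nabp i j p X = bismut_curvature i j (args X 0) (args X 1).
Proof.
move=> /andP[i_gt0 ij] j7.
have X0 : X ord0 = args X 0 by rewrite argsE.
have X1 : X ord_max = args X 1 by rewrite argsE.
rewrite /curv_form metric_frame ?i_gt0 1?(ltn_trans ij) // curvatureE X0 X1.
move: (args X 0) (args X 1) => x y {X0 X1}.
case: j i i_gt0 ij j7 => [|[|[|[|[|[|[|j]]]]]]] // [|[|[|[|[|[|i]]]]]] // _ _ _;
  rewrite !(ecoordD, ecoordN) !bismutE !bracketE !ecoord_frame //=;
  rewrite /bismut_curvature /plane /ext11;
  move: (ecoord P) => f; by ring.
Qed.

(** Up to the factor t^4, the entry (1,2) contributes 8 e^{3456}, cancelled by
-2 e^{3456} from each of (3,5), (4,6), (4,5), (3,6), and (3,4) contributes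
-8 e^{1256}, cancelled by 2 e^{1256} from each of (1,5), (2,6), (2,5), (1,6).
The rest is 8 e^{1234} from (5,6) and -6 e^{1234} from each of (1,3), (2,4),
(2,3), (1,4). *)
Lemma sum_curvature_squares (X : 'I_4 -> vec R) :
  \sum_(1 <= j < 7) \sum_(1 <= i < j)
    ext22 (bismut_curvature i j) (bismut_curvature i j)
      (args X 0) (args X 1) (args X 2) (args X 3) =
  - (16 * t ^+ 4) * e1234 P X.
Proof.
rewrite unlock /= !addr0 !add0r.
rewrite /e1234 /ext22 /bismut_curvature /plane /ext11.
move: (ecoord P) (args X 0) (args X 1) (args X 2) (args X 3) => f x y z w.
by ring.
Qed.

Lemma p1_bismutE p X :
  p1_conn br P nabp p X = - (2 * t ^+ 4 / pi ^+ 2) * e1234 P (X : 'I_4 -> _).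
Proof.
rewrite /p1_conn (_ : \sum_(1 <= j < 7) _ = - (16 * t ^+ 4) * e1234 P (X : 'I_4 -> _)).
  by have := gt_eqF (pi_gt0 R); move: pi => c /negbT c_neq0; field.
rewrite -sum_curvature_squares; apply: eq_big_nat => j /andP[_ j7].
apply: eq_big_nat => i ij.
apply: wedge22E => [Y|Y|x y|x y]; try exact: curv_formE.
all: rewrite /bismut_curvature.
all: case: j i {j7 ij} => [|[|[|[|[|[|[|j]]]]]]] [|[|[|[|[|[|i]]]]]] //=;
  rewrite ?(planeN _ _ _ x y); by ring.
Qed.

Lemma hol_in_su3_bismut : hol_in_su3 br P nabp.
Proof.
split.
- move=> p X Y Z; rewrite !metricE !bismutE; move: (ecoord P) => f; by ring.
- move=> p X Y; apply: (ecoord_inj P_unit).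
  case=> [|[|[|[|[|[|[|k]]]]]]] // _; rewrite !(jE, bismutE);
    move: (ecoord P) => f; by ring.
- move=> p X Y.
  under eq_big_nat => i i_bd.
    rewrite metric_frame // curvatureE !(ecoordD, ecoordN); over.
  (* From here on only the coordinates of J X matter. *)
  have := jE; move: (cplxJ P) => J JE.
  rewrite unlock /= addr0 !bismutE !bracketE !JE.
  rewrite !ecoord_frame; try by [].
  rewrite /=; move: (ecoord P) => f; by ring.
Qed.

(** * The balanced condition *)

Definition half_kaehler_square (x y z w : vec R) : R :=
  ext22 (e_ 1 2) (e_ 3 4) x y z w
  + ext22 (e_ 1 2) (e_ 5 6) x y z w
  + ext22 (e_ 3 4) (e_ 5 6) x y z w.

Lemma hodge_kaehler p (X : 'I_4 -> vec R) :
  hodge2 P (kaehler P) p X =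
    half_kaehler_square (args X 0) (args X 1) (args X 2) (args X 3).
Proof.
pose vol i j := volume P
  (tnth (cat_tuple [tuple frame P i; frame P j] [tuple X m | m < 4])).
pose F i j := kaehler P p (tnth [tuple frame P i; frame P j]).
have FE i j : (0 < i < 7)%N -> (0 < j < 7)%N -> F i j =
  (i == 1%N)%:R * (j == 2%N)%:R - (i == 2%N)%:R * (j == 1%N)%:R +
  ((i == 3%N)%:R * (j == 4%N)%:R - (i == 4%N)%:R * (j == 3%N)%:R) +
  ((i == 5%N)%:R * (j == 6%N)%:R - (i == 6%N)%:R * (j == 5%N)%:R).
  move=> i_bd j_bd; rewrite /F kaehlerE // /kaehler_form /plane /ext11 /args.
  by rewrite !(tnth_nth 0) !inordK //= !ecoord_frame.
have hodgeE : hodge2 P (kaehler P) p X =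
    2^-1 * (vol 1 2 - vol 2 1 + (vol 3 4 - vol 4 3) + (vol 5 6 - vol 6 5)).
  congr (_ * _).
  under eq_big_nat => i i_bd.
    under eq_big_nat => j j_bd.
      rewrite -/(F i j) -/(vol i j) FE //; over.
    over.
  rewrite unlock /=; move: vol => v; by ring.
(* The index of the second frame vector is [bump i j].+1, j being its position
   once the column of the first has been deleted. *)
have volE i j : (i < 6)%N -> (j < 5)%N -> vol i.+1 (bump i j).+1 =
    (-1) ^+ (i + j) *
      \det (\matrix_(k < 4, l < 4) e (bump i (bump j l)).+1 (X k)).
  move=> i6 j5; exact: (volume_frames P_unit X (Ordinal i6) (Ordinal j5)).
rewrite hodgeE (volE 0 0)%N // (volE 1 0)%N // (volE 2 2)%N // (volE 3 2)%N //.
rewrite (volE 4 4)%N // (volE 5 4)%N //.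
rewrite !(det_ext22 (fun l => e (bump _ (bump _ l)).+1)).
rewrite /bump /= !add1n !add0n /half_kaehler_square.
rewrite /ext22 /plane /ext11.
move: (ecoord P) (args X 0) (args X 1) (args X 2) (args X 3) => f x y z w; by field.
Qed.

Lemma balanced_h6 : balanced br P.
Proof.
move=> p X; rewrite (ext_d4E _ _ _ hodge_kaehler).
move: (args X 0) (args X 1) (args X 2) (args X 3) (args X 4) => x y z w v.
rewrite /half_kaehler_square /ext22 /plane /ext11 !bracketE.
move: (ecoord P) => f; rewrite /zero_form; by ring.
Qed.

(** * The abelian instanton *)

Variables (Gam : set (vec R)) (z1 z2 : vec R -> R[i]) (f gam : R[i] -> R[i] -> R).
Variable A : u1_connection br Gam.
Hypothesis A_inst : is_abelian_instanton W z1 z2 f gam A.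

(** The general anti-self-dual form in the first four coordinates, that is, the
general primitive form of type (1,1) in omega^1 and omega^2. *)
Definition asd_form (u a b : R) (x y : vec R) : R :=
  2 * (u * (e_ 1 2 x y - e_ 3 4 x y)
       + a * (e_ 1 3 x y + e_ 2 4 x y)
       + b * (e_ 1 4 x y - e_ 2 3 x y)).

(** The two off-diagonal terms of the curvature are complex conjugates of each
other, and omega^1 /\ bar omega^2 = e^{13} + e^{24} + i (e^{23} - e^{14}). The
bound on f makes the square root genuine, so a^2 + b^2 = 1/4 - f^2. *)
Lemma instanton_curvatureE p : exists u a b : R,
  u ^+ 2 + a ^+ 2 + b ^+ 2 = 4^-1 /\
  forall X, u1_curvature A p X = asd_form u a b (args X 0) (args X 1).
Proof.
pose u := f (z1 p) (z2 p); pose g := gam (z1 p) (z2 p).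
pose s := Num.sqrt (4^-1 - u ^+ 2).
exists u, (cos g * s), (sin g * s); split.
  have s2 : s ^+ 2 = 4^-1 - u ^+ 2.
    rewrite sqr_sqrtr // subr_ge0 -real_normK ?num_real //.
    have -> : 4^-1 = 2^-1 ^+ 2 :> R by field.
    by rewrite lerXn2r ?nnegrE // ?invr_ge0 // (inst_bound A_inst).
  by rewrite !exprMn s2 cos2sin2; ring.
move=> X; have := congr1 (@complex.Re R) (inst_curvature A_inst p X).
rewrite -/u -/g !wedge11E /conj_form /omega /eform /offdiag cosN sinN -/s /= => ->.
have X0 : X ord0 = args X 0 by rewrite argsE.
have X1 : X ord_max = args X 1 by rewrite argsE.
rewrite X0 X1 /double /=.
have [[<- <- <- <-] _] := ecoord_adapted (args X 0).
have [[<- <- <- <-] _] := ecoord_adapted (args X 1).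
rewrite /asd_form /plane /ext11.
move: (cos g) (sin g) u s (ecoord P) (args X 0) (args X 1) => c d v r h x y.
by ring.
Qed.

Lemma su3_instanton_abelian : su3_instanton P A.
Proof.
split=> p; have [u [a [b [_ FE]]]] := instanton_curvatureE p.
  move=> X; rewrite !FE /asd_form /plane /ext11 /args !jE.
  move: (ecoord P) => h; by ring.
under eq_big_nat => k k_bd.
  rewrite FE /args !(tnth_nth 0) !inordK //=; over.
have := jE; rewrite /asd_form /plane /ext11; move: (cplxJ P) => J JE.
rewrite unlock /= !JE !ecoord_frame //=; by ring.
Qed.

Lemma p1_u1E p X : p1_u1 A p X = - ((4 * pi ^+ 2)^-1) * e1234 P X.
Proof.
have [u [a [b [uab FE]]]] := instanton_curvatureE p.
have skew x y : asd_form u a b x y = - asd_form u a b y x.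
  by rewrite /asd_form !(planeN _ _ _ x y); ring.
rewrite /p1_u1 (wedge22E _ FE FE skew skew) /=.
have -> : - (4 * pi ^+ 2)^-1 =
    (8 * pi ^+ 2)^-1 * (- (8 * (u ^+ 2 + a ^+ 2 + b ^+ 2))) :> R.
  by rewrite uab; have := gt_eqF (pi_gt0 R); move: pi => c /negbT c_neq0; field.
rewrite -mulrA; congr (_ * _); rewrite /e1234 /ext22 /asd_form /plane /ext11.
move: (ecoord P) (args X 0) (args X 1) (args X 2) (args X 3) => h x y z w.
by ring.
Qed.

End BalancedStructure.

(** * The Bianchi identity *)

Theorem theorem7p1 (R : realType)
    (* the nilmanifold M_6 = Gam \ G *)
    (br : bracket R) (br_lie : is_lie_bracket br) (br_h6 : is_h6 br)
    (Gam : set (vec R)) (Gam_lattice : is_lattice br Gam)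
    (* the Hermitian structure *)
    (W : 'M[R]_6) (W_coframe : is_complex_coframe br W)
    (t : R) (t_neq0 : t != 0)
    (P : 'M[R]_6) (P_adapted : is_adapted t W P)
    (* the Levi-Civita and Bismut-Strominger connections *)
    (nabg : connection R) (nabg_lc : is_levi_civita br P nabg)
    (nabp : connection R) (nabp_bismut : is_bismut br P nabg nabp)
    (* the abelian instanton *)
    (z1 z2 : vec R -> R[i]) (f gam : R[i] -> R[i] -> R)
    (A : u1_connection br Gam)
    (A_inst : is_abelian_instanton W z1 z2 f gam A) :
  (8 * t ^+ 4 != 1 -> forall p X,
     ext_d br (torsion br P) p X =
     32 * pi ^+ 2 * t ^+ 2 / (8 * t ^+ 4 - 1)
       * (p1_conn br P nabp p X - p1_u1 A p X))
  /\
  (8^-1 < t ^+ 4 ->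
     [/\ heterotic_susy P nabp A,
         ~ (torsion br P =2 zero_form)
       & bianchi_identity P nabp A]).
Proof.
have P_unit := adapted_basis P_adapted.
have anomaly : 8 * t ^+ 4 != 1 -> forall p X, ext_d br (torsion br P) p X =
     32 * pi ^+ 2 * t ^+ 2 / (8 * t ^+ 4 - 1) *
       (p1_conn br P nabp p X - p1_u1 A p X).
  move=> t4 p X; rewrite (ext_d_torsion W_coframe P_adapted).
  rewrite (p1_bismutE W_coframe P_adapted nabg_lc nabp_bismut).
  rewrite (p1_u1E P_adapted A_inst).
  have := gt_eqF (pi_gt0 R); move: pi (e1234 P X) => c v /negbT c_neq0.
  by field; rewrite c_neq0 subr_eq0 t4.
split=> // t4.
have t4_gt0 : 8 * t ^+ 4 - 1 > 0 by rewrite subr_gt0 -ltr_pdivrMl // mulr1.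
split.
- split.
  + exact: (hol_in_su3_bismut W_coframe P_adapted nabg_lc nabp_bismut).
  + exact: (balanced_h6 W_coframe P_adapted).
  + exact: (su3_instanton_abelian P_adapted A_inst).
- (* T (E_2, E_4, E_5) = 2t *)
  move=> /(_ 0 (tnth [tuple frame P 2; frame P 4; frame P 5])).
  rewrite (torsionE W_coframe P_adapted) /args !(tnth_nth 0) !inordK //=.
  rewrite /torsion_form /plane /ext11 !ecoord_frame //= /zero_form => /eqP; apply/negP.
  rewrite (_ : _ * _ = 2 * t); last by ring.
  by rewrite mulf_neq0.
(* alpha' / 4 * 8 pi^2 is the factor in the first part of the statement. *)
exists (16 * t ^+ 2 / (8 * t ^+ 4 - 1)).
  by rewrite divr_gt0 // mulr_gt0 // exprn_even_gt0.
move=> p X; rewrite anomaly; last by rewrite -subr_eq0 gt_eqF.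
by congr (_ * _); move: pi (gt_eqF t4_gt0) => c /negbT den_neq0; field.
Qed.
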